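(* Let $f\in\mathcal{C}^{2r}(-b,b)$ ($b>0$, integer $r\ge1$) with $f^{(2\ell-1)}(0)=0$ for $1\le\ell<r$ and $f^{(2r-1)}(0)\ne0$. Let $\mathbf{x}_1,\ldots,\mathbf{x}_n\in\mathbb{R}^d$ with $n\ge\#\mathbb{P}_{r-1}$, and $\mathbf{K}_\varepsilon=[f(\varepsilon\|\mathbf{x}_i-\mathbf{x}_j\|_2)]_{i,j=1}^n$. Assume that for some $\varepsilon_0>0$, $\mathbf{K}_\varepsilon$ is positive semidefinite on $[0,\varepsilon_0]$ and analytic in $\varepsilon$ near $0$. Let $\mathbf{Q}_\perp\in\mathbb{R}^{n\times(n-\#\mathbb{P}_{r-1})}$ consist of the last $n-\#\mathbb{P}_{r-1}$ columns of the orthogonal factor of a full QR factorization of $\mathbf{V}_{\le r-1}$. If $\det\mathbf{W}_{r-1}\ne0$, $\mathbf{V}_{\le r-1}$ has full column rank, and $\mathbf{Q}_\perp^\top\mathbf{D}_{(2r-1)}\mathbf{Q}_\perp$ is invertible, then the limiting eigenvectors corresponding to the last group of $n-\#\mathbb{P}_{r-1}$ eigenvalues of $\mathbf{K}_\varepsilon$ (those of order $\mathcal{O}(\varepsilon^{2r-1})$) are given by the columns of $\mathbf{Q}_\perp\mathbf{U}$, where the columns of $\mathbf{U}$ are eigenvectors of $\mathbf{Q}_\perp^\top\mathbf{D}_{(2r-1)}\mathbf{Q}_\perp$.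
   Context: Multi-indices: $\mathbb{P}_k=\{\boldsymbol\alpha\in\mathbb{Z}_+^d:\sum_i\alpha_i\le k\}$, $\#\mathbb{P}_k=\binom{k+d}{d}$; with a fixed graded order on multi-indices, $\mathbf{V}_{\le k}=[\mathbf{x}_i^{\boldsymbol\alpha}]_{i\le n,\boldsymbol\alpha\in\mathbb{P}_k}$ where $\mathbf{x}^{\boldsymbol\alpha}=\prod_jx_j^{\alpha_j}$. $\mathbf{D}_{(k)}=[\|\mathbf{x}_i-\mathbf{x}_j\|_2^k]_{i,j}$. $\mathbf{W}_{r-1}$ is the matrix indexed by $\mathbb{P}_{r-1}\times\mathbb{P}_{r-1}$ whose $(\boldsymbol\alpha,\boldsymbol\beta)$ entry is $\frac{K^{(\boldsymbol\alpha,\boldsymbol\beta)}(\mathbf{0},\mathbf{0})}{\boldsymbol\alpha!\boldsymbol\beta!}$ for $K(\mathbf{x},\mathbf{y})=f(\|\mathbf{x}-\mathbf{y}\|_2)$, equivalently the coefficient of $\mathbf{x}^{\boldsymbol\alpha}\mathbf{y}^{\boldsymbol\beta}$ in $\sum_{m=0}^{r-1}\frac{f^{(2m)}(0)}{(2m)!}\|\mathbf{x}-\mathbf{y}\|_2^{2m}$. The eigenvalues of $\mathbf{K}_\varepsilon$ in nonincreasing order consist of groups of orders $\mathcal{O}(\varepsilon^{2s})$, $s=0,\ldots,r-1$, followed by the last $n-\#\mathbb{P}_{r-1}$ eigenvalues of order $\mathcal{O}(\varepsilon^{2r-1})$. Limiting eigenvectors: eigenvalues and orthogonal rank-one eigenprojectors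 $\mathbf{P}(\varepsilon)$ of an analytic symmetric matrix function can be chosen analytic near $0$; a limiting eigenvector $\mathbf{p}$ satisfies $\mathbf{P}(0)=\mathbf{p}\mathbf{p}^\top$ (up to sign). *)

(* Defs.v *)
From HB Require Import structures.
From mathcomp Require Import all_boot all_order all_algebra.
From mathcomp Require Import mpoly.
From mathcomp Require Import all_classical all_reals all_analysis.

Set Implicit Arguments.
Unset Strict Implicit.
Unset Printing Implicit Defensive.

Import Order.TTheory GRing.Theory Num.Theory.
Import numFieldNormedType.Exports.
Local Open Scope classical_set_scope.
Local Open Scope ring_scope.

Section Defs.
Variable R : realType.

Definition enorm (d : nat) (v : 'rV[R]_d) : R := Num.sqrt (\sum_(k < d) v 0 k ^+ 2).

Definition mis (d k : nat) : seq 'X_{1..d} :=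
  path.sort (fun a c : 'X_{1..d} => (mdeg a <= mdeg c)%N)
    (seq.filter (fun a : 'X_{1..d} => (mdeg a <= k)%N)
       (map val (enum {: 'X_{1..d < k.+1}}))).

Definition nP (d k : nat) : nat := size (mis d k).

Definition mi (d k : nat) (a : nat) : 'X_{1..d} := nth mnm0 (mis d k) a.

Definition Vmx (n d k : nat) (x : 'I_n -> 'rV[R]_d) : 'M[R]_(n, nP d k) :=
  \matrix_(i < n, a < nP d k) \prod_(j < d) (x i 0 j) ^+ (mi d k a j).

Definition Dmx (n d k : nat) (x : 'I_n -> 'rV[R]_d) : 'M[R]_n :=
  \matrix_(i, j) enorm (x i - x j) ^+ k.

Definition Kmx (n d : nat) (f : R -> R) (x : 'I_n -> 'rV[R]_d) (e : R) : 'M[R]_n :=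
  \matrix_(i, j) f (e * enorm (x i - x j)).

(* the polynomial sum_{m=0}^{k} f^(2m)(0)/(2m)! ||x - y||^(2m) in the 2d
   variables x_1..x_d (indices lshift) and y_1..y_d (indices rshift) *)
Definition Kpoly (d k : nat) (f : R -> R) : {mpoly R[d + d]} :=
  \sum_(m < k.+1)
     (derive1n (2 * m) f 0 / ((2 * m)`!)%:R) *:
       (\sum_(j < d) ('X_(lshift d j) - 'X_(rshift d j)) ^+ 2) ^+ m.

Definition joinmn (d : nat) (a c : 'X_{1..d}) : 'X_{1..d + d} :=
  [multinom (match fintype.split i with inl j => a j | inr j => c j end) | i < d + d].

Definition Wmx (d k : nat) (f : R -> R) : 'M[R]_(nP d k) :=
  \matrix_(a, c) (Kpoly d k f)@_(joinmn (mi d k a) (mi d k c)).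

Definition Qperp (n m : nat) (Q : 'M[R]_n) : 'M[R]_(n, n - m) :=
  \matrix_(i < n, j < n - m) Q i (insubd i (m + j)%N).

Definition upper_trig (n m : nat) (A : 'M[R]_(n, m)) : Prop :=
  forall (i : 'I_n) (j : 'I_m), (j < i)%N -> A i j = 0.

Definition psd (n : nat) (M : 'M[R]_n) : Prop :=
  forall v : 'cV[R]_n, 0 <= (v^T *m M *m v) 0 0.

Definition Ck_on (k : nat) (b : R) (f : R -> R) : Prop :=
  (forall i, (i < k)%N -> forall t, -b < t < b -> derivable (derive1n i f) t 1)
  /\ (forall t, -b < t < b -> derive1n k f s @[s --> t] --> derive1n k f t).

Definition analytic0 (g : R -> R) : Prop :=
  exists2 delta : R, 0 < delta &
    exists a : nat -> R, forall e, `|e| < delta ->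
      \sum_(k < N) a k * e ^+ k @[N --> \oo] --> g e.

Definition analytic_mx0 (n : nat) (M : R -> 'M[R]_n) : Prop :=
  forall i j, analytic0 (fun e => M e i j).

(* analytic eigen-decomposition near 0 (Rellich): analytic eigenvalues and
   analytic orthogonal rank-one eigenprojectors *)
Definition analytic_eigdec (n : nat) (K : R -> 'M[R]_n)
    (lam : 'I_n -> R -> R) (P : 'I_n -> R -> 'M[R]_n) : Prop :=
  (forall i, analytic0 (lam i)) /\ (forall i, analytic_mx0 (P i)) /\
  exists2 delta : R, 0 < delta & forall e, `|e| < delta ->
    [/\ forall i, (P i e)^T = P i e,
        forall i j, P i e *m P j e = (if i == j then P i e else 0),
        forall i, \rank (P i e) = 1%N &
        K e = \sum_(i < n) lam i e *: P i e].

Definition bigO_pow (p : nat) (g : R -> R) : Prop :=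
  exists C : R, exists2 delta : R, 0 < delta &
    forall e, 0 < e < delta -> `|g e| <= C * e ^+ p.

Definition eigvec (m : nat) (A : 'M[R]_m) (v : 'cV[R]_m) : Prop :=
  v != 0 /\ exists mu : R, A *m v = mu *: v.

End Defs.

(* Main.v *)
Require Import Defs.
From HB Require Import structures.
From mathcomp Require Import all_boot all_order all_algebra.
From mathcomp Require Import mpoly.
From mathcomp Require Import all_classical all_reals all_analysis.
From mathcomp Require Import zify ring lra.
Import Order.TTheory GRing.Theory Num.Theory.
Import numFieldNormedType.Exports.
Local Open Scope classical_set_scope.
Local Open Scope ring_scope.

(** With k = r - 1, Taylor expansion gives
      K(e) = V Δ W Δ V^T + V Δ H + G Δ V^T + c e^(2k+1) D + O(e^(2k+2)),
    where Δ = diag(e^|α|), H and G are O(e^(k+1)), and c <> 0.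
    If lam = O(e^(2k+1)), invertibility of W and the equation K P = lam P yield
    Δ V^T P = O(e^(k+1)); hence V^T P(0) = 0, and projecting K P = lam P on the
    orthogonal complement of V leaves c Qp^T D P(0) proportional to Qp^T P(0).
    If lam is not O(e^(2k+1)), positive semidefiniteness of K and
    Qp^T K Qp = O(e^(2k+1)) force Qp^T P(0) = 0. So the limiting projectors of
    the small eigenvalues sum to Qp Qp^T, and comparing traces shows that there
    are exactly n - #P_k of them. *)

(** * Order estimates as [e] tends to 0 from the right *)

Section BigO.
Context {R : realType}.
Implicit Types (p q s : nat) (g h : R -> R).

(** This has the shape of the inner clause of [bigO_pow], so that [bigO_pow p g] unfolds to a
    [near0p] statement for some constant. Only positive [e] are seen, which makes division by powers
    of [e] harmless. *)
Definition near0p (A : R -> Prop) : Prop :=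
  exists2 delta : R, 0 < delta & forall e, 0 < e < delta -> A e.

Lemma near0p_and (A B : R -> Prop) :
  near0p A -> near0p B -> near0p (fun e => A e /\ B e).
Proof.
move=> [a a0 hA] [c c0 hB]; exists (Num.min a c); first by rewrite lt_min a0.
move=> e; rewrite lt_min => /and3P[e0 ea ec].
by split; [apply: hA|apply: hB]; apply/andP.
Qed.

Lemma near0p_imp {A} (B : R -> Prop) :
  near0p A -> (forall e, 0 < e -> A e -> B e) -> near0p B.
Proof.
move=> [a a0 hA] AB; exists a => // e /andP[e0 ea].
by apply: AB => //; apply: hA; rewrite e0.
Qed.

Lemma near0p_lt (a : R) : 0 < a -> near0p (fun e => e < a).
Proof. by move=> a0; exists a => // e /andP[]. Qed.

Lemma bigO_ext p g h :
  near0p (fun e => g e = h e) -> bigO_pow p h -> bigO_pow p g.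
Proof.
move=> gh [C hC]; exists C; apply: (near0p_imp _ (near0p_and _ _ gh hC)).
by move=> e _ [-> ].
Qed.

Lemma bigO_add p g h :
  bigO_pow p g -> bigO_pow p h -> bigO_pow p (fun e => g e + h e).
Proof.
move=> [C hC] [D hD]; exists (C + D).
apply: (near0p_imp _ (near0p_and _ _ hC hD)) => e _ [h1 h2].
by rewrite mulrDl (le_trans (ler_normD _ _))// lerD.
Qed.

Lemma bigO_opp p g : bigO_pow p g -> bigO_pow p (fun e => - g e).
Proof. by move=> [C hC]; exists C; apply: (near0p_imp _ hC) => e _; rewrite normrN. Qed.

Lemma bigO_mul p q g h :
  bigO_pow p g -> bigO_pow q h -> bigO_pow (p + q) (fun e => g e * h e).
Proof.
move=> [C hC] [D hD]; exists (C * D).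
apply: (near0p_imp _ (near0p_and _ _ hC hD)) => e _ [h1 h2].
by rewrite normrM exprD mulrACA ler_pM.
Qed.

Lemma bigO_const (c : R) : bigO_pow 0 (fun _ => c).
Proof. by exists `|c|; exists 1 => // e _; rewrite expr0 mulr1. Qed.

Lemma bigO_exp p : bigO_pow p (fun e : R => e ^+ p).
Proof. by exists 1; exists 1 => // e /andP[e0 _]; rewrite mul1r ger0_norm// exprn_ge0// ltW. Qed.

Lemma bigO_weaken p q g : (p <= q)%N -> bigO_pow q g -> bigO_pow p g.
Proof.
(* [C] carries no sign, hence [|C|]; near 0 also e < 1, so e^q <= e^p. *)
move=> pq [C hC]; exists `|C|.
apply: (near0p_imp _ (near0p_and _ _ hC (near0p_lt 1 ltr01))) => e e0 [h1 h2].
apply: (le_trans h1); rewrite (le_trans (ler_norm _))// normrM ler_wpM2l//.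
by rewrite ger0_norm ?exprn_ge0 ?(ltW e0)// ler_wiXn2l// ltW.
Qed.

Lemma bigO_sum p (I : Type) (l : seq I) (P : pred I) (F : I -> R -> R) :
  (forall i, P i -> bigO_pow p (F i)) ->
  bigO_pow p (fun e => \sum_(i <- l | P i) F i e).
Proof.
move=> hF; elim: l => [|i l IH].
  apply: (bigO_ext _ _ (fun=> 0)); first by exists 1 => // e _; rewrite big_nil.
  (* The empty sum is O(e^p) as the product of the constant 0 with e^p. *)
  exact: bigO_weaken (bigO_ext _ _ _ (ex_intro2 _ _ 1 ltr01 (fun e _ => esym (mul0r (e ^+ p)))) (bigO_mul _ _ _ _ (bigO_const 0) (bigO_exp p))).
case Pi: (P i).
  apply: bigO_ext (bigO_add _ _ _ (hF i Pi) IH).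
  by exists 1 => // e _; rewrite big_cons Pi.
by apply: bigO_ext IH; exists 1 => // e _; rewrite big_cons Pi.
Qed.

Lemma bigO_div s p g : bigO_pow (s + p) (fun e => e ^+ s * g e) -> bigO_pow p g.
Proof.
move=> [C hC]; exists C; apply: (near0p_imp _ hC) => e e0.
rewrite normrM exprD mulrCA (ger0_norm (exprn_ge0 _ (ltW e0))).
by rewrite ler_pM2l// exprn_gt0.
Qed.

Lemma bigO1_const_eq0 (c : R) : bigO_pow 1 (fun _ => c) -> c = 0.
Proof.
move=> [C [a a0 hC]]; apply/eqP; rewrite -normr_eq0; apply/eqP/le_anti.
rewrite normr_ge0 andbT; apply/ler_addgt0Pr => t t0; rewrite add0r.
(* Small enough to lie in the range of the estimate and to give (|C| + 1) e <= t; the 1 keeps the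
   denominator positive. *)
pose e := Num.min (a / 2) (t / (`|C| + 1)).
have C1 : 0 < `|C| + 1 by rewrite ltr_wpDl.
have e0 : 0 < e by rewrite lt_min !divr_gt0.
have ea : e < a by rewrite gt_min ltr_pdivrMr// ltr_pMr// ltr1n.
apply: (le_trans (hC e _)); first by rewrite e0.
rewrite expr1 (le_trans (ler_wpM2r (ltW e0) (ler_norm C)))//.
rewrite (@le_trans _ _ ((`|C| + 1) * e)) ?ler_wpM2r ?(ltW e0) ?lerDl//.
by rewrite mulrC -ler_pdivlMr// ge_min lexx orbT.
Qed.

(** Uniqueness of the limit: [g] tends to [c] and to 0, and c = g - (g - c) is a constant of order
    O(e). *)
Lemma bigO_vanish g (c : R) :
  bigO_pow 1 (fun e => g e - c) -> bigO_pow 1 g -> c = 0.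
Proof.
move=> h1 h2; apply: bigO1_const_eq0.
by apply: bigO_ext (bigO_add _ _ _ h2 (bigO_opp _ _ h1)); exists 1 => // e _; ring.
Qed.

(** For small [e], |h e| >= |c|/2, so dividing by [h] only costs the constant factor 2/|c|. *)
Lemma bigO_cancel p g h (c : R) : c != 0 ->
  bigO_pow 1 (fun e => h e - c) -> bigO_pow p (fun e => g e * h e) -> bigO_pow p g.
Proof.
move=> c0 [C hC] [D hD]; have c_gt0 : 0 < `|c| by rewrite normr_gt0.
have C1 : 0 < `|C| + 1 by rewrite ltr_wpDl.
exists (D / (`|c| / 2)).
(* Below this threshold C e <= |c|/2. *)
have k0 : 0 < `|c| / 2 / (`|C| + 1) by rewrite !divr_gt0.
apply: (near0p_imp _ (near0p_and _ _ (near0p_lt _ k0) (near0p_and _ _ hC hD))).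
move=> e e0 [ek [h1 h2]].
rewrite mulrAC ler_pdivlMr ?divr_gt0//; apply: le_trans h2; rewrite normrM ler_wpM2l//.
have h3 : C * e ^+ 1 <= `|c| / 2.
  rewrite expr1 (le_trans (ler_wpM2r (ltW e0) (ler_norm C)))//.
  rewrite (@le_trans _ _ ((`|C| + 1) * e)) ?ler_wpM2r ?(ltW e0) ?lerDl//.
  by rewrite mulrC -ler_pdivlMr// ltW.
have h4 : `|c| <= `|h e| + `|h e - c|.
  by rewrite -[X in `|X|](subKr (h e)) (le_trans (ler_normB _ _)).
lra.
Qed.

(** * Entrywise orders of matrix functions *)

Definition mxO (m n p : nat) (M : R -> 'M[R]_(m, n)) : Prop :=
  forall i j, bigO_pow p (fun e => M e i j).
Arguments mxO {m n} p M.

Lemma mxO_ext m n p (M N : R -> 'M[R]_(m, n)) :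
  near0p (fun e => M e = N e) -> mxO p N -> mxO p M.
Proof.
move=> h hN i j; apply: bigO_ext (hN i j).
by apply: near0p_imp h _ => e _ ->.
Qed.

Lemma mxO_add m n p (M N : R -> 'M[R]_(m, n)) :
  mxO p M -> mxO p N -> mxO p (fun e => M e + N e).
Proof.
move=> hM hN i j; apply: bigO_ext (bigO_add _ _ _ (hM i j) (hN i j)).
by exists 1 => // e _; rewrite mxE.
Qed.

Lemma mxO_opp m n p (M : R -> 'M[R]_(m, n)) :
  mxO p M -> mxO p (fun e => - M e).
Proof.
move=> hM i j; apply: bigO_ext (bigO_opp _ _ (hM i j)).
by exists 1 => // e _; rewrite mxE.
Qed.

Lemma mxO_mul l m n p q (M : R -> 'M[R]_(l, m)) (N : R -> 'M[R]_(m, n)) :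
  mxO p M -> mxO q N -> mxO (p + q) (fun e => M e *m N e).
Proof.
move=> hM hN i j.
apply: bigO_ext (bigO_sum _ _ _ xpredT _ (fun k _ => bigO_mul _ _ _ _ (hM i k) (hN k j))).
by exists 1 => // e _; rewrite mxE.
Qed.

Lemma mxO_scale m n p q g (M : R -> 'M[R]_(m, n)) :
  bigO_pow p g -> mxO q M -> mxO (p + q) (fun e => g e *: M e).
Proof.
move=> hg hM i j; apply: bigO_ext (bigO_mul _ _ _ _ hg (hM i j)).
by exists 1 => // e _; rewrite mxE.
Qed.

Lemma mxO_const m n (M : 'M[R]_(m, n)) : mxO 0 (fun=> M).
Proof. by move=> i j; exact: bigO_const. Qed.

Lemma mxO_weaken m n p q (M : R -> 'M[R]_(m, n)) :
  (p <= q)%N -> mxO q M -> mxO p M.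
Proof. by move=> pq hM i j; apply: bigO_weaken (hM i j). Qed.

Lemma mxO_div m n s p (M : R -> 'M[R]_(m, n)) :
  mxO (s + p) (fun e => e ^+ s *: M e) -> mxO p M.
Proof.
move=> hM i j; apply: (bigO_div s); apply: bigO_ext (hM i j).
by exists 1 => // e _; rewrite mxE.
Qed.

Lemma mxO_vanish m n (M : R -> 'M[R]_(m, n)) (M0 : 'M[R]_(m, n)) :
  mxO 1 (fun e => M e - M0) -> mxO 1 M -> M0 = 0.
Proof.
move=> h1 h2; apply/matrixP => i j; rewrite [RHS]mxE.
apply: bigO_vanish (h2 i j); apply: bigO_ext (h1 i j).
by exists 1 => // e _; rewrite !mxE.
Qed.

(* Bootstrapping: each use of the equation improves the known order of y by one. *)
Lemma mxO_bootstrap m n s t (y M1 : R -> 'M[R]_(m, n)) (M2 : R -> 'M[R]_m) :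
  near0p (fun e => e ^+ s *: y e = M1 e + M2 e *m y e) ->
  mxO (s + t) M1 -> mxO s.+1 M2 -> mxO 0 y -> mxO t y.
Proof.
move=> hy h1 h2 h0.
suff H k : (k <= t)%N -> mxO k y by exact: H.
elim: k => [//|k IH] kt; apply: (mxO_div _ _ s); apply: mxO_ext hy _.
apply: mxO_add; first by apply: mxO_weaken h1; rewrite leq_add2l.
by rewrite -addSnnS; apply: mxO_mul => //; apply: IH; exact: ltnW.
Qed.

End BigO.
Arguments mxO {R m n} p M.

(** * Estimates for power series and Taylor remainders *)

Section Analysis.
Context {R : realType}.

Lemma geometric_sum_le2 (q : R) N : 0 <= q <= 2^-1 -> \sum_(k < N) q ^+ k <= 2.
Proof.
move=> /andP[q0 q2].
(* The sharper bound is what passes through the induction, because 2 q^(N+1) <= q^N. *)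
suff: \sum_(k < N) q ^+ k <= 2 - 2 * q ^+ N.
  by move=> h; apply: (le_trans h); rewrite gerBl mulr_ge0 ?exprn_ge0.
elim: N => [|N IH]; first by rewrite big_ord0 expr0; lra.
rewrite big_ord_recr/= exprS; have : q * q ^+ N <= 2^-1 * q ^+ N by rewrite ler_wpM2r ?exprn_ge0.
lra.
Qed.

(** At e0 = delta/2 the series converges, so its terms are bounded by some M. For e <= e0/2 the tail
    is then dominated by a geometric series of ratio q = e/e0 <= 1/2, which gives |g e - g 0| <= 2 M
    q. *)
Lemma analytic0_bigO1 (g : R -> R) : analytic0 g -> bigO_pow 1 (fun e => g e - g 0).
Proof.
move=> [delta d0 [a ha]].
have g0 : g 0 = a 0%N.
  have h0 : \sum_(k < N) a k * 0 ^+ k @[N --> \oo] --> a 0%N.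
    apply: cvg_near_cst; exists 1%N => // -[//|N] _ /=.
    rewrite big_ord_recl expr0 mulr1 big1 ?addr0// => i _.
    by rewrite expr0n mulr0.
  have h1 := ha 0; rewrite normr0 in h1.
  exact: (cvg_unique (@norm_hausdorff _ R^o) (h1 d0) h0).
pose e0 := delta / 2.
have e0_gt0 : 0 < e0 by rewrite divr_gt0.
have e0N : `|e0| < delta by rewrite gtr0_norm// ltr_pdivrMr// ltr_pMr// ltr1n.
have [M hM] : exists M, forall k, `|a k * e0 ^+ k| <= M.
  have cs : cvgn (series (fun k => a k * e0 ^+ k)).
    apply/cvg_ex; exists (g e0); rewrite /series/=.
    by under eq_fun do rewrite big_mkord; exact: ha.
  have /cvg_seq_bounded[M [_ hM]] : cvgn (fun k => a k * e0 ^+ k).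
    by apply/cvg_ex; exists 0; exact: cvg_series_cvg_0.
  by exists (M + 1) => k; apply: (hM (M + 1)) => //; rewrite ltrDl.
have M0 : 0 <= M by apply: le_trans (hM 0%N).
exists (M * 2 / e0); exists (e0 / 2); first by rewrite divr_gt0.
move=> e /andP[e_gt0 ee]; rewrite expr1.
pose q := e / e0.
have q0 : 0 <= q by rewrite divr_ge0 ?ltW.
have q2 : q <= 2^-1 by rewrite ler_pdivrMr// mulrC ltW.
have ed : `|e| < delta.
  by rewrite gtr0_norm// (lt_trans ee)//; rewrite /e0; lra.
have hN N : `|\sum_(k < N.+1) a k * e ^+ k - a 0%N| <= M * 2 / e0 * e.
  rewrite big_ord_recl expr0 mulr1 addrC addKr.
  apply: (le_trans (ler_norm_sum _ _ _)).
  have -> : M * 2 / e0 * e = M * q * 2 by rewrite /q; field; rewrite gt_eqF.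
  apply: (@le_trans _ _ (\sum_(k < N) M * q * q ^+ k)).
    apply: ler_sum => k _; rewrite -mulrA -exprS lift0.
    have -> : a k.+1 * e ^+ k.+1 = a k.+1 * e0 ^+ k.+1 * q ^+ k.+1.
      rewrite -mulrA -exprMn; congr (_ * _ ^+ _).
      by rewrite /q; field; rewrite gt_eqF.
    by rewrite normrM (ger0_norm (exprn_ge0 _ q0)) ler_wpM2r ?exprn_ge0.
  rewrite -mulr_sumr ler_wpM2l ?(mulr_ge0 M0 q0)//.
  by apply: geometric_sum_le2; rewrite q0.
rewrite g0.
have cv : `|\sum_(k < N.+1) a k * e ^+ k - a 0%N| @[N --> \oo] --> `|g e - a 0%N|.
  apply: cvg_norm; apply: cvgB; last exact: cvg_cst.
  have := ha e ed; rewrite -(cvg_shiftn 1).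
  by under eq_fun do rewrite addn1.
rewrite -(cvg_lim (@norm_hausdorff _ R^o) cv).
apply: limr_le; first by apply/cvg_ex; eexists; exact: cv.
by near=> N; exact: hN.
Unshelve. all: by end_near. Qed.

(* Induction on the order, applied to the derivative, with the mean value theorem on [0, t]. *)
Lemma taylor_bound (m : nat) (f : R -> R) (a M : R) :
  (forall i t, (i < m)%N -> 0 <= t < a -> derivable (derive1n i f) t 1) ->
  (forall t, 0 <= t < a -> `|derive1n m f t| <= M) ->
  forall t, 0 <= t < a ->
  `|f t - \sum_(k < m) derive1n k f 0 / k`!%:R * t ^+ k| <= M * t ^+ m.
Proof.
elim: m f => [|m IH] f hd hM t ta.
  by rewrite big_ord0 subr0 expr0 mulr1; exact: hM.
have IH' := IH (f^`()%classic) _ _.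
have {IH'} IH' : forall t, 0 <= t < a ->
    `|f^`()%classic t - \sum_(k < m) derive1n k.+1 f 0 / k`!%:R * t ^+ k| <= M * t ^+ m.
  move=> u ua; have := IH' _ _ u ua.
  under eq_bigr do rewrite -derive1Sn.
  apply => [i v im va|v va].
    by rewrite -derive1Sn; apply: hd.
  by rewrite -derive1Sn; apply: hM.
(* The point t = 0 is treated apart, since the mean value theorem is applied on a nondegenerate
   interval. *)
move: ta => /andP[]; rewrite le_eqVlt => /predU1P[<- _|t0 ta].
  rewrite big_ord_recl big1 => [|i _]; last by rewrite lift0 expr0n/= mulr0.
  by rewrite fact0 expr0 divr1 mulr1 addr0 subrr normr0 expr0n mulr0.
pose h u := f u - \sum_(k < m.+1) derive1n k f 0 / k`!%:R * u ^+ k.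
(* The derivative of the remainder [h] is the remainder of order [m] of the derivative of [f], which
   [IH'] bounds. *)
pose dh u := f^`()%classic u - \sum_(k < m) derive1n k.+1 f 0 / k`!%:R * u ^+ k.
have h0 : h 0 = 0.
  rewrite /h big_ord_recl big1 => [|i _]; last by rewrite lift0 expr0n/= mulr0.
  by rewrite fact0 expr0 divr1 mulr1 addr0 derive1n0 subrr.
have hder u : 0 <= u < a -> is_derive u 1 h (dh u).
  move=> ua; rewrite /h /dh derive1E; apply: is_deriveB.
    by apply: DeriveDef => //; exact: (hd 0%N).
  have -> : (fun u => \sum_(k < m.+1) derive1n k f 0 / k`!%:R * u ^+ k) =
      \sum_(k < m.+1) (fun u => derive1n k f 0 / k`!%:R * u ^+ k).
    by apply/funext => v; rewrite fct_sumE.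
  (* Reindexing into termwise derivatives: the term k = 0 vanishes through its factor [k%:R], and
     (k+1)/(k+1)! = 1/k!. *)
  have -> : \sum_(k < m) derive1n k.+1 f 0 / k`!%:R * u ^+ k =
      \sum_(k < m.+1) derive1n k f 0 / k`!%:R * (k%:R * u ^+ k.-1).
    rewrite big_ord_recl/= mul0r mulr0 add0r; apply: eq_bigr => i _.
    rewrite /bump/= add1n factS natrM invfM -!mulrA; congr (_ * _).
    by rewrite mulrCA mulKf// pnatr_eq0.
  apply: is_derive_sum => k.
  have := @is_deriveZ _ R^o R^o (fun u : R => u ^+ k : R) (derive1n k f 0 / k`!%:R) u 1
    (k%:R * u ^+ k.-1).
  apply.
  have := @is_deriveX _ R^o id k u 1 1 (is_derive_id _ _).
  by rewrite /GRing.scale/= mulr1 exprfctE.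
have hcont : {within `[0, t], continuous h}.
  apply: derivable_within_continuous => u; rewrite in_itv/= => /andP[u0 ut].
  have hu : 0 <= u < a by rewrite u0 (le_lt_trans ut).
  by have [] := hder u hu.
have [|c] := @MVT R h dh 0 t t0 _ hcont.
  by move=> u; rewrite in_itv/= => /andP[u0 ut]; apply: hder; rewrite ltW//= (lt_trans ut).
rewrite in_itv/= => /andP[c0 ct]; rewrite h0 !subr0 -/(h t) => ->.
rewrite normrM (gtr0_norm t0) exprSr mulrA ler_pM//; first exact: ltW.
apply: (le_trans (IH' c _)); first by rewrite (ltW c0) (lt_trans ct).
have M0 : 0 <= M by apply: le_trans (hM 0 _) => //; rewrite lexx (lt_trans t0).
by rewrite ler_wpM2l// lerXn2r ?nnegrE// ltW.
Qed.

End Analysis.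

(** * Taylor expansion of the radial function, and its even part as a polynomial in two groups of
    variables *)

Section KernelExpansion.
Context {R : realType}.
Variables (d k : nat).

Lemma big_ord_double (F : nat -> R) r :
  \sum_(j < 2 * r) F j = \sum_(m < r) (F (2 * m)%N + F (2 * m).+1).
Proof.
elim: r => [|r IH]; first by rewrite !big_ord0.
by rewrite mulnS 2!big_ord_recr big_ord_recr/= IH addrA.
Qed.

(** In the Taylor polynomial of degree 2k+1, paired as 2m and 2m+1, every odd term but the last one
    vanishes. *)
Lemma kernel_taylor (b : R) (f : R -> R) (s : R) :
  0 < b -> Ck_on (2 * k.+1) b f ->
  (forall l : nat, (1 <= l < k.+1)%N -> derive1n (2 * l).-1 f 0 = 0) -> 0 <= s ->
  bigO_pow (2 * k.+1) (fun e => f (e * s)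
    - (\sum_(m < k.+1) derive1n (2 * m) f 0 / (2 * m)`!%:R * (e * s) ^+ (2 * m)
       + derive1n (2 * k).+1 f 0 / (2 * k).+1`!%:R * (e * s) ^+ (2 * k).+1)).
Proof.
move=> b0 [fd fc] fodd s0.
(* Continuity of the top derivative at 0, with tolerance 1, bounds it near 0. *)
have [a a0 [ab fM]] : exists2 a : R, 0 < a & a <= b /\ forall t, 0 <= t < a ->
    `|derive1n (2 * k.+1) f t| <= `|derive1n (2 * k.+1) f 0| + 1.
  have /cvgrPdist_le/(_ 1 ltr01)/nbhs_ballP[a /= a0 ha] := fc 0 ltac:(rewrite b0 andbT; lra).
  exists (Num.min a b); first by rewrite lt_min a0.
  split; first by rewrite ge_min lexx orbT.
  move=> t /andP[t0]; rewrite lt_min => /andP[ta tb].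
  have := ha t; rewrite /ball/= sub0r normrN ger0_norm// => /(_ ta) h.
  by rewrite addrC -lerBlDr (le_trans (lerB_dist _ _))// distrC.
have fda i t : (i < 2 * k.+1)%N -> 0 <= t < a -> derivable (derive1n i f) t 1.
  move=> ik /andP[t0 ta]; apply: fd => //; apply/andP; split; first by lra.
  exact: lt_le_trans ab.
have tb := taylor_bound (2 * k.+1) f a _ fda fM.
pose F t j := derive1n j f 0 / j`!%:R * t ^+ j.
have FE t : \sum_(j < 2 * k.+1) F t j =
    \sum_(m < k.+1) F t (2 * m)%N + F t (2 * k).+1.
  rewrite big_ord_double big_split/=; congr (_ + _).
  rewrite big_ord_recr/= big1 ?add0r// => m _.
  have := fodd m.+1; rewrite mulnS /F => -> //; first by rewrite !mul0r.
  by rewrite /= ltnS ltn_ord.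
exists ((`|derive1n (2 * k.+1) f 0| + 1) * s ^+ (2 * k.+1)).
(* Guarantees e s < a, also when s = 0. *)
exists (a / (s + 1)); first by rewrite divr_gt0// ltr_wpDl.
move=> e /andP[e0 ea]; have sp1 : 0 < s + 1 by rewrite ltr_wpDl.
have h : 0 <= e * s < a.
  rewrite mulr_ge0 ?(ltW e0)//=; rewrite ltr_pdivlMr// in ea; apply: le_lt_trans ea.
  by rewrite ler_wpM2l ?lerDl// ltW.
rewrite -[leRHS]mulrA -exprMn (mulrC s e).
by have := tb _ h; rewrite (FE (e * s)).
Qed.

Definition mon (a : 'X_{1..d}) (v : 'rV[R]_d) : R := \prod_(j < d) v 0 j ^+ a j.
Definition lmn (u : 'X_{1..d + d}) : 'X_{1..d} := [multinom u (lshift d j) | j < d].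
Definition rmn (u : 'X_{1..d + d}) : 'X_{1..d} := [multinom u (rshift d j) | j < d].

Lemma joinmn_eq (a c : 'X_{1..d}) u : (joinmn a c == u) = (a == lmn u) && (c == rmn u).
Proof.
apply/eqP/andP => [<-|[/eqP-> /eqP->]].
  by split; apply/eqP/mnmP => j; rewrite !mnmE ?(unsplitK (inl _ j)) ?(unsplitK (inr _ j)).
by apply/mnmP => i; rewrite mnmE; case: splitP => j /= ij; rewrite mnmE;
  congr (u _); apply/val_inj.
Qed.

Lemma mdeg_lrmn u : mdeg u = (mdeg (lmn u) + mdeg (rmn u))%N.
Proof.
rewrite !mdegE big_split_ord/=.
by congr (_ + _)%N; apply: eq_bigr => j _; rewrite mnmE.
Qed.

Lemma mon_scale (e : R) a v : mon a (e *: v) = e ^+ mdeg a * mon a v.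
Proof.
rewrite /mon mdegE expr_sum -big_split/=.
by apply: eq_bigr => j _; rewrite mxE exprMn.
Qed.

Lemma mem_mis a : (a \in mis d k) = (mdeg a <= k)%N.
Proof.
rewrite mem_sort mem_filter; case: leqP => //= ak.
apply/mapP; have h : (mdeg a < k.+1)%N by [].
by exists (BMultinom h) => //; rewrite mem_enum.
Qed.

Lemma mis_uniq : uniq (mis d k).
Proof. by rewrite sort_uniq filter_uniq// map_inj_uniq ?enum_uniq//; exact: val_inj. Qed.

(** [mis] has no duplicates, so at most one index contributes. This collapses the sums hidden in
    matrix products over multi-indices. *)
Lemma sum_mi (F : 'X_{1..d} -> R) a :
  \sum_(i < nP d k) F (mi d k i) * (mi d k i == a)%:R = (mdeg a <= k)%N%:R * F a.
Proof.
have -> : \sum_(i < nP d k) F (mi d k i) * (mi d k i == a)%:R =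
    \sum_(c <- mis d k) F c * (c == a)%:R by rewrite (big_nth mnm0) big_mkord.
rewrite -mem_mis; case: (boolP (a \in _)) => am.
  rewrite (bigD1_seq a)//= ?mis_uniq// eqxx mulr1 mul1r big1 ?addr0//.
  by move=> c /negPf ->; rewrite mulr0.
rewrite mul0r big_seq big1// => c cm; case: eqP => [ca|_]; last by rewrite mulr0.
by rewrite ca (negPf am) in cm.
Qed.

(** The summand of index m is homogeneous of degree 2m, with m <= k. *)
Lemma Kpoly_degree f u : u \in msupp (Kpoly d k f : {mpoly R[d + d]}) -> (mdeg u <= 2 * k)%N.
Proof.
rewrite mcoeff_msupp; apply: contraNT; rewrite -ltnNge => hu; apply/eqP.
rewrite /Kpoly raddf_sum/= big1// => m _; rewrite mcoeffZ.
have hom : ((\sum_(j < d) ('X_(lshift d j) - 'X_(rshift d j)) ^+ 2) ^+ m : {mpoly R[d + d]})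
    \is (2 * m).-homog.
  apply: dhomogMn; apply: rpred_sum => j _; rewrite -[2%N]/(1 * 2)%N; apply: dhomogMn.
  by apply: rpredB; rewrite dhomogX; apply/eqP; exact: mdeg1.
rewrite (dhomog_nemf_coeff hom) ?mulr0//.
by rewrite neq_ltn (leq_trans _ hu) ?orbT// ltnS leq_mul2l/= -ltnS.
Qed.

(** Both sides are the value of [Kpoly] at the joined point (v, w), computed from its coefficients
    and from its definition. *)
Lemma Kpoly_meval f (v w : 'rV[R]_d) :
  \sum_(u <- msupp (Kpoly d k f : {mpoly R[d + d]}))
     (Kpoly d k f)@_u * (mon (lmn u) v * mon (rmn u) w) =
  \sum_(m < k.+1) derive1n (2 * m) f 0 / (2 * m)`!%:R * enorm (v - w) ^+ (2 * m).
Proof.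
pose z (i : 'I_(d + d)) := match fintype.split i with inl j => v 0 j | inr j => w 0 j end.
transitivity ((Kpoly d k f).@[z]).
  rewrite mevalE; apply: eq_bigr => u _; rewrite big_split_ord/=; congr (_ * (_ * _)).
    by apply: eq_bigr => j _; rewrite mnmE /z (unsplitK (inl _ j)).
  by apply: eq_bigr => j _; rewrite mnmE /z (unsplitK (inr _ j)).
rewrite /Kpoly raddf_sum/=; apply: eq_bigr => m _.
rewrite mevalZ rmorphXn/= raddf_sum/= exprM; congr (_ * _ ^+ _).
rewrite sqr_sqrtr ?sumr_ge0// => [|j _]; last exact: sqr_ge0.
apply: eq_bigr => j _.
by rewrite rmorphXn/= mevalB !mevalXU /z (unsplitK (inl _ j)) (unsplitK (inr _ j)) !mxE.
Qed.
End KernelExpansion.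

(** * Matrix form of the expansion *)

Section KernelMatrix.
Context {R : realType}.
Variables (n d k : nat) (f : R -> R) (x : 'I_n -> 'rV[R]_d).

Let N := nP d k.
Let Kp : {mpoly R[d + d]} := Kpoly d k f.
Let supp := msupp Kp.

(* The even part of the expansion of K is V Δ W Δ V^T + V Δ H + G Δ V^T with
   Δ = degmx: H and G collect the monomials x^α y^β with |β| > k, resp. |α| > k.
   The total degree is at most 2k, so both cannot happen at once. *)
Definition degmx (e : R) : 'M[R]_N := diag_mx (\row_a e ^+ mdeg (mi d k a)).

Definition Hmx (e : R) : 'M[R]_(N, n) := \matrix_(a, j)
  \sum_(u <- supp) (mi d k a == lmn d u)%:R *
     ((k < mdeg (rmn d u))%N%:R * Kp@_u * mon d (rmn d u) (e *: x j)).

Definition Gmx (e : R) : 'M[R]_(n, N) := \matrix_(i, c)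
  \sum_(u <- supp) (mi d k c == rmn d u)%:R *
     ((k < mdeg (lmn d u))%N%:R * Kp@_u * mon d (lmn d u) (e *: x i)).

(** Spreading a coefficient over the support lets the product with W be compared monomial by
    monomial with those of H and G. *)
Lemma Wmx_sum a c : Wmx d k f a c =
  \sum_(u <- supp) (mi d k a == lmn d u)%:R * ((mi d k c == rmn d u)%:R * Kp@_u).
Proof.
rewrite mxE -/Kp; set u0 := joinmn _ _.
transitivity (\sum_(u <- supp) (u0 == u)%:R * Kp@_u); last first.
  by apply: eq_bigr => u _; rewrite joinmn_eq mulrA -natrM mulnb.
case: (boolP (u0 \in supp)) => h.
  rewrite (bigD1_seq u0)//= ?msupp_uniq// eqxx mul1r big1 ?addr0//.
  by move=> u; rewrite eq_sym => /negPf ->; rewrite mul0r.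
rewrite big_seq big1 => [|u us]; first by apply/eqP; rewrite mcoeff_eq0.
by case: eqP => [uu|_]; [rewrite uu us in h|rewrite mul0r].
Qed.

(** A monomial of degree m at e v is e^m times its value at v; the indicator keeps only m > k. *)
Lemma mon_bigO (F : 'X_{1..d + d} -> 'X_{1..d}) (C : 'X_{1..d + d} -> R)
    (B : pred 'X_{1..d + d}) v :
  bigO_pow k.+1 (fun e => \sum_(u <- supp) (B u)%:R *
    ((k < mdeg (F u))%N%:R * C u * mon d (F u) (e *: v))).
Proof.
apply: bigO_sum => u _.
case: (ltnP k (mdeg (F u))) => h.
  apply: (bigO_weaken _ _ _ h).
  apply: bigO_ext (bigO_mul 0 _ _ _ (bigO_const ((B u)%:R * C u * mon d (F u) v)) (bigO_exp (mdeg (F u)))).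
  by exists 1 => // e _; rewrite mon_scale mul1r; ring.
apply: (bigO_weaken _ k.+1.+1) => //.
apply: bigO_ext (bigO_mul 0 _ _ _ (bigO_const 0) (bigO_exp k.+2)).
by exists 1 => // e _; rewrite !(mul0r, mulr0).
Qed.

Lemma Hmx_bigO : mxO k.+1 Hmx.
Proof.
move=> a j; apply: bigO_ext (mon_bigO (rmn d) (fun u => Kp@_u) (fun u => mi d k a == lmn d u) (x j)).
by exists 1 => // e _; rewrite mxE.
Qed.

Lemma Gmx_bigO : mxO k.+1 Gmx.
Proof.
move=> i c; apply: bigO_ext (mon_bigO (lmn d) (fun u => Kp@_u) (fun u => mi d k c == rmn d u) (x i)).
by exists 1 => // e _; rewrite mxE.
Qed.

Lemma Vdeg e i a : (Vmx k x *m degmx e) i a = mon d (mi d k a) (e *: x i).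
Proof. by rewrite mul_mx_diag !mxE mon_scale mulrC. Qed.

Lemma degV e a j : (degmx e *m (Vmx k x)^T) a j = mon d (mi d k a) (e *: x j).
Proof. by rewrite mul_diag_mx !mxE mon_scale. Qed.

(** Each product becomes a sum over the support of [Kpoly], restricted by conditions on the degrees
    in x and in y. The three restrictions are disjoint and, by [Kpoly_degree], cover the support. *)
Lemma even_part e :
  \matrix_(i, j) \sum_(m < k.+1) derive1n (2 * m) f 0 / (2 * m)`!%:R
     * (e * enorm (x i - x j)) ^+ (2 * m) =
  Vmx k x *m degmx e *m Wmx d k f *m (degmx e *m (Vmx k x)^T)
  + Vmx k x *m degmx e *m Hmx e + Gmx e *m (degmx e *m (Vmx k x)^T).
Proof.
apply/matrixP => i j; rewrite [LHS]mxE [RHS]mxE [X in _ = X + _]mxE.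
pose A a := mon d a (e *: x i); pose B a := mon d a (e *: x j).
have -> : (Vmx k x *m degmx e *m Hmx e) i j =
    \sum_(u <- supp) (mdeg (lmn d u) <= k)%N%:R * (k < mdeg (rmn d u))%N%:R *
      (Kp@_u * (A (lmn d u) * B (rmn d u))).
  rewrite mxE; under eq_bigr do rewrite Vdeg [Hmx e _ _]mxE mulr_sumr.
  rewrite exchange_big/=; apply: eq_bigr => u _.
  under eq_bigr do rewrite (mulrA (mon d _ _)).
  by rewrite -mulr_suml (sum_mi _ _ A) /A /B; ring.
have -> : (Gmx e *m (degmx e *m (Vmx k x)^T)) i j =
    \sum_(u <- supp) (mdeg (rmn d u) <= k)%N%:R * (k < mdeg (lmn d u))%N%:R *
      (Kp@_u * (A (lmn d u) * B (rmn d u))).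
  rewrite mxE; under eq_bigr do rewrite degV [Gmx e _ _]mxE (mulrC _ (mon d _ (e *: x j))) mulr_sumr.
  rewrite exchange_big/=; apply: eq_bigr => u _.
  under eq_bigr do rewrite (mulrA (mon d _ _)).
  by rewrite -mulr_suml (sum_mi _ _ B) /A /B; ring.
have -> : (Vmx k x *m degmx e *m Wmx d k f *m (degmx e *m (Vmx k x)^T)) i j =
    \sum_(u <- supp) (mdeg (lmn d u) <= k)%N%:R * (mdeg (rmn d u) <= k)%N%:R *
      (Kp@_u * (A (lmn d u) * B (rmn d u))).
  transitivity (\sum_(c < N) \sum_(u <- supp)
      (B (mi d k c) * (mi d k c == rmn d u)%:R) *
      ((mdeg (lmn d u) <= k)%N%:R * A (lmn d u) * Kp@_u)).
    rewrite mxE; apply: eq_bigr => c _; rewrite degV -/(B _) mxE.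
    under eq_bigr do rewrite Vdeg -/(A _) Wmx_sum mulr_sumr.
    rewrite exchange_big/= mulr_suml; apply: eq_bigr => u _.
    under eq_bigr do rewrite (mulrA (mon d _ _)).
    by rewrite -mulr_suml (sum_mi _ _ A) /A /B; ring.
  rewrite exchange_big/=; apply: eq_bigr => u _.
  by rewrite -mulr_suml (sum_mi _ _ B); ring.
rewrite -!big_split/=.
transitivity (\sum_(u <- supp) Kp@_u * (A (lmn d u) * B (rmn d u))).
  rewrite Kpoly_meval; apply: eq_bigr => m _; congr (_ * _).
  rewrite !exprM; congr (_ ^+ _).
  rewrite exprMn !sqr_sqrtr ?sumr_ge0// => [|c _|c _]; try exact: sqr_ge0.
  by rewrite mulr_sumr; apply: eq_bigr => c _; rewrite !mxE; ring.
(* The three indicators add up to 1; the case of two degrees above k contradicts the bound 2k on the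
   total degree. *)
apply: eq_big_seq => u us; rewrite -!mulrDl -[LHS]mul1r; congr (_ * _).
have := Kpoly_degree _ _ _ _ us; rewrite mdeg_lrmn => hd.
have [h1|h1] := leqP (mdeg (lmn d u)) k; have [h2|h2] := leqP (mdeg (rmn d u)) k;
  rewrite ?(mul0r, mulr0, mul1r, addr0, add0r)//.
by exfalso; move: hd; rewrite leqNgt => /negP; apply; rewrite mul2n -addnn -addSn leq_add// ltnW.
Qed.

Lemma Kmx_expansion (b : R) : 0 < b -> Ck_on (2 * k.+1) b f ->
  (forall l : nat, (1 <= l < k.+1)%N -> derive1n (2 * l).-1 f 0 = 0) ->
  exists2 E : R -> 'M[R]_n, mxO (2 * k.+1) E & forall e,
  Kmx f x e =
  Vmx k x *m degmx e *m Wmx d k f *m (degmx e *m (Vmx k x)^T)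
  + Vmx k x *m degmx e *m Hmx e + Gmx e *m (degmx e *m (Vmx k x)^T)
  + (derive1n (2 * k).+1 f 0 / (2 * k).+1`!%:R * e ^+ (2 * k).+1) *: Dmx (2 * k).+1 x
  + E e.
Proof.
move=> b0 hf fodd; eexists (fun e => Kmx f x e -
  (\matrix_(i, j) \sum_(m < k.+1) derive1n (2 * m) f 0 / (2 * m)`!%:R
     * (e * enorm (x i - x j)) ^+ (2 * m) +
   (derive1n (2 * k).+1 f 0 / (2 * k).+1`!%:R * e ^+ (2 * k).+1) *: Dmx (2 * k).+1 x)).
  move=> i j.
  apply: bigO_ext (kernel_taylor k b f (enorm (x i - x j)) b0 hf fodd (sqrtr_ge0 _)).
  by exists 1 => // e _; rewrite !mxE exprMn; congr (_ - (_ + _)); rewrite mulrA.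
by move=> e; rewrite even_part addrCA subrr addr0.
Qed.
End KernelMatrix.

(** * Symmetric projectors and orthogonal complements *)

Section LinearAlgebra.
Context {R : realType}.

(** The trace is the sum of the squares of all entries. *)
Lemma trmul_eq0 m n (A : 'M[R]_(m, n)) : \tr (A *m A^T) = 0 -> A = 0.
Proof.
rewrite /mxtrace => h; apply/matrixP => i j; rewrite mxE.
have sq_ge0 a : 0 <= (A *m A^T) a a.
  by rewrite mxE sumr_ge0// => b _; rewrite mxE -expr2 sqr_ge0.
have /(_ i isT) := psumr_eq0P (fun a _ => sq_ge0 a) h.
rewrite mxE => /psumr_eq0P/(_ j isT); rewrite mxE => hj.
apply/eqP; rewrite -sqrf_eq0 expr2 hj// => b _.
by rewrite mxE -expr2 sqr_ge0.
Qed.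

Lemma trmulT_eq0 m n (A : 'M[R]_(m, n)) : \tr (A^T *m A) = 0 -> A = 0.
Proof. by rewrite mxtrace_mulC; exact: trmul_eq0. Qed.

(** A rank factorization P = a w gives P = P P^T = (w w^T) a a^T, so v is [a] scaled by the square
    root of w w^T. *)
Lemma rank1_projector n (P : 'M[R]_n) : P^T = P -> P *m P = P -> \rank P = 1%N ->
  exists v : 'cV[R]_n, [/\ P = v *m v^T, v^T *m v = 1%:M & P *m v = v].
Proof.
move=> PT PP rP.
have P0 : P != 0 by rewrite -mxrank_eq0 rP.
have [a [w Paw]] : exists (a : 'cV[R]_n) (w : 'rV[R]_n), P = a *m w.
  move: (col_base P) (row_base P) (mulmx_base P); rewrite rP => a w aw.
  by exists a, w.
have ww : w *m w^T = ((w *m w^T) 0 0)%:M by exact: mx11_scalar.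
set s := (w *m w^T) 0 0 in ww.
have s0 : 0 <= s by rewrite /s mxE sumr_ge0// => b _; rewrite mxE -expr2 sqr_ge0.
pose v := Num.sqrt s *: a.
have Pv : P = v *m v^T.
  rewrite -PP -{2}PT Paw trmx_mul mulmxA -(mulmxA a) ww.
  rewrite /v linearZ/= -scalemxAl -scalemxAr scalerA -expr2 sqr_sqrtr//.
  by rewrite mul_mx_scalar scalemxAl.
have vv : v^T *m v = ((v^T *m v) 0 0)%:M by exact: mx11_scalar.
have v1 : v^T *m v = 1%:M.
  have : P *m P = ((v^T *m v) 0 0) *: P.
    by rewrite Pv mulmxA -(mulmxA v) {1}vv mul_mx_scalar scalemxAl.
  rewrite PP -{1}[P]scale1r => /eqP; rewrite -subr_eq0 -scalerBl scaler_eq0 (negPf P0) orbF.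
  by rewrite subr_eq0 => /eqP vv1; rewrite vv -vv1.
by exists v; split => //; rewrite Pv -mulmxA v1 mulmx1.
Qed.

Lemma rank1_projector_trace n (P : 'M[R]_n) :
  P^T = P -> P *m P = P -> \rank P = 1%N -> \tr P = 1.
Proof.
move=> PT PP rP; have [v [-> v1 _]] := rank1_projector _ _ PT PP rP.
by rewrite mxtrace_mulC v1 mxtrace1.
Qed.

(** The difference 1 - S is a symmetric idempotent of trace n - n = 0, hence zero. *)
Lemma projectors_sum1 n (P : 'I_n -> 'M[R]_n) :
  (forall i, (P i)^T = P i) ->
  (forall i j, P i *m P j = (if i == j then P i else 0)) ->
  (forall i, \rank (P i) = 1%N) -> \sum_i P i = 1%:M.
Proof.
move=> PT PP rP; pose S := \sum_i P i.
have PiS i : P i *m S = P i.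
  rewrite /S mulmx_sumr (bigD1 i)//= PP eqxx big1 ?addr0// => j.
  by rewrite PP eq_sym => /negPf ->.
have SS : S *m S = S by rewrite {1}/S mulmx_suml; apply: eq_bigr => i _; exact: PiS.
have ST : S^T = S by rewrite /S linear_sum/=; apply: eq_bigr => i _; exact: PT.
apply/esym/eqP; rewrite -subr_eq0 -/S; apply/eqP; apply: trmul_eq0.
rewrite linearB/= trmx1 ST mulmxBl mul1mx mulmxBr mulmx1 SS subrr subr0.
have trS : \tr S = n%:R.
  rewrite /S raddf_sum (eq_bigr (fun=> 1)); first by rewrite sumr_const card_ord.
  by move=> i _; apply: rank1_projector_trace => //; rewrite PP eqxx.
suff -> : \tr (1%:M - S) = \tr (1%:M : 'M[R]_n) - \tr S.
  by rewrite mxtrace1 trS subrr.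
exact: raddfB.
Qed.

Section Qperp.
Variables (n N : nat) (Q : 'M[R]_n).
Hypothesis Q1 : Q^T *m Q = 1%:M.
Hypothesis Nn : (N <= n)%N.

(** Since N + j < n, the default value of [insubd] in [Qperp] is never returned. *)
Lemma Qperp_val (j : 'I_(n - N)) (i0 : 'I_n) : insubd i0 (N + j)%N = (N + j)%N :> nat.
Proof. by rewrite val_insubd -ltn_subRL ltn_ord. Qed.

Lemma Qperp_orth : (Qperp N Q)^T *m Qperp N Q = 1%:M.
Proof.
apply/matrixP => a c; rewrite !mxE.
have an : (N + a < n)%N by rewrite -ltn_subRL.
have cn : (N + c < n)%N by rewrite -ltn_subRL.
have := congr1 (fun M : 'M[R]_n => M (Ordinal an) (Ordinal cn)) Q1.
rewrite !mxE -val_eqE/= eqn_add2l => <-; apply: eq_bigr => i _; rewrite !mxE.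
by congr (Q _ _ * Q _ _); apply/val_inj; rewrite /= Qperp_val.
Qed.

(** The entries are those of Q^T Q A = A in the rows from N on, which vanish for an upper triangular
    A with N columns. *)
Lemma Qperp_QR (A : 'M[R]_(n, N)) : upper_trig A -> (Qperp N Q)^T *m (Q *m A) = 0.
Proof.
move=> Au; apply/matrixP => a c; rewrite [RHS]mxE.
have an : (N + a < n)%N by rewrite -ltn_subRL.
rewrite -(Au (Ordinal an) c); last by rewrite /= (leq_trans (ltn_ord c))// leq_addr.
have {2}-> : A = Q^T *m (Q *m A) by rewrite mulmxA Q1 mul1mx.
rewrite !mxE.
apply: eq_bigr => i _; rewrite !mxE; congr (Q _ _ * _).
by apply/val_inj; rewrite /= Qperp_val.
Qed.
End Qperp.

(** By a rank count the rows of B^T span the whole left kernel of V, so X = B Z^T for some Z, and B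
    B^T fixes it. *)
Lemma orth_complement n N m (V : 'M[R]_(n, N)) (B : 'M[R]_(n, n - N)) (X : 'M[R]_(n, m)) :
  (N <= n)%N -> \rank V = N -> B^T *m B = 1%:M -> B^T *m V = 0 -> V^T *m X = 0 ->
  B *m B^T *m X = X.
Proof.
move=> Nn rV BB BV VX.
have rB : \rank B^T = (n - N)%N.
  apply/eqP; rewrite -[_ == _]/(row_free B^T); apply/row_freeP; by exists B.
have BK : (B^T <= kermx V)%MS by apply/sub_kermxP.
have KB : (kermx V <= B^T)%MS.
  by rewrite -(geq_leqif (mxrank_leqif_sup BK)) rB mxrank_ker rV.
have : (X^T <= B^T)%MS.
  by apply: submx_trans KB; apply/sub_kermxP; rewrite -[LHS]trmxK trmx_mul trmxK VX trmx0.
case/submxP => Z XZ; have -> : X = B *m Z^T by rewrite -[LHS]trmxK XZ trmx_mul trmxK.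
by rewrite mulmxA -(mulmxA B) BB mulmx1.
Qed.
End LinearAlgebra.

(** * Passing to the limit in the eigenvalue equation *)

Section Limits.
Context {R : realType}.

(** Cross-multiplying two entries eliminates [g]: e^s times a 2 by 2 minor of (X, Y) is O(e^(s+1)),
    so that minor vanishes in the limit. A nonzero entry of X0 then gives the ratio. *)
Lemma mxO_proportional m n s (g : R -> R) (X Y : R -> 'M[R]_(m, n)) X0 Y0 :
  mxO 1 (fun e => X e - X0) -> mxO 1 (fun e => Y e - Y0) ->
  mxO s.+1 (fun e => g e *: X e - e ^+ s *: Y e) -> X0 != 0 ->
  exists mu, Y0 = mu *: X0.
Proof.
move=> hX hY hXY X0n0.
have entryO (Z : R -> 'M[R]_(m, n)) Z0 i j : mxO 1 (fun e => Z e - Z0) ->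
    bigO_pow 1 (fun e => Z e i j - Z0 i j).
  by move=> hZ; apply: bigO_ext (hZ i j); exists 1 => // e _; rewrite !mxE.
have entryO0 (Z : R -> 'M[R]_(m, n)) Z0 i j : mxO 1 (fun e => Z e - Z0) ->
    bigO_pow 0 (fun e => Z e i j).
  move=> hZ; have := bigO_add _ _ _ (bigO_weaken 0 _ _ _ (entryO _ _ i j hZ)) (bigO_const (Z0 i j)).
  move=> /(_ isT); apply: bigO_ext; exists 1 => // e _; ring.
have prodO i j i' j' : bigO_pow 1 (fun e => X e i j * Y e i' j' - X0 i j * Y0 i' j').
  have h1 := bigO_mul _ _ _ _ (entryO _ _ i j hX) (entryO0 _ _ i' j' hY).
  have h2 := bigO_mul _ _ _ _ (bigO_const (X0 i j)) (entryO _ _ i' j' hY).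
  by apply: bigO_ext (bigO_add _ _ _ h1 h2); exists 1 => // e _; ring.
have cross i j i' j' : X0 i j * Y0 i' j' = X0 i' j' * Y0 i j.
  apply/eqP; rewrite -subr_eq0; apply/eqP.
  apply: (bigO_vanish (fun e => X e i j * Y e i' j' - X e i' j' * Y e i j)).
    apply: bigO_ext (bigO_add _ _ _ (prodO i j i' j') (bigO_opp _ _ (prodO i' j' i j))).
    by exists 1 => // e _; ring.
  apply: (bigO_div s); rewrite addn1.
  have h1 := bigO_mul 0 _ _ _ (entryO0 _ _ i' j' hX) (hXY i j).
  have h2 := bigO_mul 0 _ _ _ (entryO0 _ _ i j hX) (hXY i' j').
  apply: bigO_ext (bigO_add _ _ _ h1 (bigO_opp _ _ h2)).
  by exists 1 => // e _; rewrite !mxE; ring.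
have /matrix0Pn[i [j Xij]] := X0n0.
exists (Y0 i j / X0 i j); apply/matrixP => i' j'; rewrite mxE.
by apply: (mulfI Xij); rewrite cross; field.
Qed.

Lemma analytic_mx0_mxO n (P : R -> 'M[R]_n) :
  analytic_mx0 P -> mxO 1 (fun e => P e - P 0).
Proof.
move=> hP i j; apply: bigO_ext (analytic0_bigO1 _ (hP i j)).
by exists 1 => // e _; rewrite !mxE.
Qed.

Lemma mxO_of_sub m n (M : R -> 'M[R]_(m, n)) M0 :
  mxO 1 (fun e => M e - M0) -> mxO 0 M.
Proof.
move=> hM; apply: mxO_ext (mxO_add _ _ _ _ _ (mxO_weaken _ _ 0 _ _ _ hM) (mxO_const _ _ M0)) => //.
by exists 1 => // e _; rewrite subrK.
Qed.

Lemma mxO_mull l m n (A : 'M[R]_(l, m)) p (M : R -> 'M[R]_(m, n)) :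
  mxO p M -> mxO p (fun e => A *m M e).
Proof. by move=> hM; apply: (mxO_mul _ _ _ 0%N) => //; exact: mxO_const. Qed.

(** * Eigenvalues of order O(e^(2k+1)) *)

Section SmallEigenvalue.
Variables (d n k : nat) (f : R -> R) (x : 'I_n -> 'rV[R]_d).
Let N := nP d k.
Let V := Vmx k x.
Let W := Wmx d k f.
Let D := Dmx (2 * k).+1 x.
Let dm : R -> 'M[R]_N := degmx d k.
Let H := Hmx n d k f x.
Let G := Gmx n d k f x.
Variables (c : R) (E : R -> 'M[R]_n).
Hypothesis EO : mxO (2 * k.+1) E.
Hypothesis KE : forall e, Kmx f x e =
  V *m dm e *m W *m (dm e *m V^T)
  + V *m dm e *m H e + G e *m (dm e *m V^T)
  + (c * e ^+ (2 * k).+1) *: D + E e.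
Variables (lam : R -> R) (P : R -> 'M[R]_n) (P0 : 'M[R]_n).
Hypothesis lamO : bigO_pow (2 * k).+1 lam.
Hypothesis PO : mxO 1 (fun e => P e - P0).
Hypothesis KP : near0p (fun e => Kmx f x e *m P e = lam e *: P e).
Hypothesis Wu : W \in unitmx.
Hypothesis Vfull : row_full V.

Let P_O0 : mxO 0 P. Proof. exact: mxO_of_sub PO. Qed.

(** This is e^k Δ^-1 written without division; the subtraction is exact because all degrees are at
    most k. *)
Definition codegmx (e : R) : 'M[R]_N :=
  diag_mx (\row_a e ^+ (k - mdeg (mi d k a))).

Lemma codeg_deg e : codegmx e *m dm e = (e ^+ k)%:M.
Proof.
apply/matrixP => a b; rewrite mul_diag_mx !mxE.
case: eqP => [->|]; rewrite ?mulr0// !mulr1n -exprD subnK//.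
by rewrite -mem_mis mem_nth.
Qed.

Lemma diag_bigO0 (p : 'I_N -> nat) : mxO 0 (fun e : R => diag_mx (\row_a e ^+ p a)).
Proof.
move=> a b; apply: (bigO_ext _ _ (fun e => (a == b)%:R * e ^+ p a)).
  by exists 1 => // e _; rewrite !mxE mulr_natl; case: eqP => [->|].
apply: bigO_mul 0 0 _ _ (bigO_const _) _.
by apply: (bigO_weaken _ (p a)) => //; exact: bigO_exp.
Qed.

Let y e := dm e *m V^T *m P e.

(* Multiplying K P = lam P on the left by e^k Δ^-1 L, with L a left inverse of V,
   gives e^k W y = O(e^(2k+1)) + O(e^(k+1)) y for y = Δ V^T P. *)
Lemma moments_bigO : mxO k.+1 y.
Proof.
have [L LV] : exists L, L *m V = 1%:M by apply/row_fullP.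
pose T := codegmx.
have T0 : mxO 0 T := diag_bigO0 _.
pose Rm e := (c * e ^+ (2 * k).+1) *: D + E e.
have Rm0 : mxO (2 * k).+1 Rm.
  apply: mxO_add; last by apply: mxO_weaken EO; rewrite mulnS.
  apply: (mxO_weaken _ _ _ ((2 * k).+1 + 0)); first by lia.
  apply: mxO_scale; last exact: mxO_const.
  exact: bigO_mul 0 _ _ _ (bigO_const c) (bigO_exp (2 * k).+1).
(* [M1] gathers the terms free of y, all of order k + (k+1); [M2] comes from G and has order k+1. *)
pose M1 e := invmx W *m (lam e *: (T e *m (L *m P e)) - e ^+ k *: (H e *m P e)
   - T e *m (L *m (Rm e *m P e))).
pose M2 e := - (invmx W *m (T e *m (L *m G e))).
apply: (mxO_bootstrap _ _ k k.+1 y M1 M2).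
- apply: near0p_imp KP _ => e _ KPe.
  have TLV (Z : 'M[R]_(N, n)) : T e *m (L *m (V *m dm e *m Z)) = e ^+ k *: Z.
    by rewrite !mulmxA -(mulmxA (T e)) LV mulmx1 codeg_deg mul_scalar_mx.
  have : lam e *: (T e *m (L *m P e)) = e ^+ k *: (W *m y e) + e ^+ k *: (H e *m P e)
      + T e *m (L *m (G e *m y e)) + T e *m (L *m (Rm e *m P e)).
    transitivity (T e *m (L *m (Kmx f x e *m P e))); first by rewrite KPe -!scalemxAr.
    rewrite KE -[_ + (c * _) *: _ + _]addrA -/(Rm e).
    rewrite !mulmxDl !mulmxDr -[V *m dm e *m W *m _ *m _]mulmxA -/(y e).
    rewrite -[V *m dm e *m W *m y e]mulmxA TLV -[V *m dm e *m H e *m _]mulmxA TLV.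
    by rewrite -[G e *m _ *m P e]mulmxA -/(y e).
  move=> eq1; rewrite /M1 /M2 eq1 -[e ^+ k *: y e](mulKmx Wu) -scalemxAr.
  rewrite mulNmx -!mulmxA -mulmxBr; congr (_ *m _).
  have alg (a b t u : 'M[R]_(N, n)) : a = a + b + t + u - b - u - t.
    by rewrite [_ - b - u]addrAC addrK [_ - b - t]addrAC !addrK.
  exact: alg.
- apply: mxO_mull; apply: mxO_add; first apply: mxO_add.
  + apply: (mxO_weaken _ _ _ ((2 * k).+1 + 0)); first by lia.
    apply: mxO_scale => //; apply: (mxO_mul _ _ _ 0 0) => //; exact: mxO_mull.
  + apply: mxO_opp; apply: mxO_scale; first exact: bigO_exp.
    rewrite -[k.+1]addn0; apply: mxO_mul => //; exact: Hmx_bigO.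
  + apply: mxO_opp; apply: (mxO_weaken _ _ _ (0 + ((2 * k).+1 + 0))); first by lia.
    by apply: mxO_mul => //; apply: mxO_mull; apply: mxO_mul.
- apply: mxO_opp; apply: mxO_mull; apply: (mxO_mul _ _ _ 0 k.+1) => //.
  apply: mxO_mull; exact: Gmx_bigO.
- apply: (mxO_mul _ _ _ 0 0) => //; apply: (mxO_mul _ _ _ 0 0) (mxO_const _ _ _).
  exact: diag_bigO0.
Qed.

(** Multiplying y = O(e^(k+1)) by e^k Δ^-1 gives e^k V^T P = O(e^(k+1)); dividing by e^k leaves V^T
    P = O(e). *)
Lemma small_orth : V^T *m P0 = 0.
Proof.
apply: (mxO_vanish _ _ (fun e => V^T *m P e)).
  apply: mxO_ext (mxO_mull _ _ _ V^T _ _ PO).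
  by exists 1 => // e _; rewrite mulmxBr.
apply: (mxO_div _ _ k); rewrite addn1.
apply: mxO_ext (mxO_mul _ _ _ 0 _ codegmx _ (diag_bigO0 _) moments_bigO).
exists 1 => // e _; rewrite /y !mulmxA codeg_deg.
by rewrite mul_scalar_mx scalemxAl.
Qed.

(** Multiplication by B^T kills the terms starting with V. Both G y and E P are O(e^(2k+2)), so lam
    B^T P and c e^(2k+1) B^T D P agree to that order. *)
Lemma small_eigen m (B : 'M[R]_(n, m)) : B^T *m V = 0 -> c != 0 -> B^T *m P0 != 0 ->
  exists mu, B^T *m D *m P0 = mu *: (B^T *m P0).
Proof.
move=> BV c0 BP0.
have [|||mu hmu] := @mxO_proportional _ _ (2 * k).+1 lam (fun e => B^T *m P e)
  (fun e => c *: (B^T *m D *m P e)) (B^T *m P0) (c *: (B^T *m D *m P0)) _ _ _ BP0.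
- apply: mxO_ext (mxO_mull _ _ _ B^T _ _ PO).
  by exists 1 => // e _; rewrite mulmxBr.
- apply: mxO_ext (mxO_scale _ _ 0 _ _ _ (bigO_const c) (mxO_mull _ _ _ (B^T *m D) _ _ PO)).
  by exists 1 => // e _; rewrite mulmxBr scalerBr.
- apply: (mxO_ext _ _ _ _ (fun e => B^T *m (G e *m y e) + B^T *m (E e *m P e))).
    apply: near0p_imp KP _ => e _ KPe.
    rewrite (scalemxAr (lam e)) -KPe KE !mulmxDl !mulmxDr -!mulmxA.
    rewrite !(mulmxA B^T V) BV !mul0mx !add0r -/(y e) -scalemxAl -scalemxAr scalerA.
    by rewrite (mulrC c) addrAC addrK /y -!mulmxA.
  apply: mxO_add; apply: mxO_mull.
    apply: (mxO_weaken _ _ _ (k.+1 + k.+1)); first by lia.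
    by apply: mxO_mul; [exact: Gmx_bigO|exact: moments_bigO].
  apply: (mxO_weaken _ _ _ (2 * k.+1 + 0)); first by lia.
  exact: mxO_mul.
by exists (c^-1 * mu); rewrite -scalerA -hmu scalerA mulVf// scale1r.
Qed.
End SmallEigenvalue.
End Limits.

(** * Eigenvalues that are not O(e^(2k+1)) *)

Section LargeEigenvalue.
Context {R : realType}.

(* Positivity gives lam_i v^T P_i v <= v^T K v, so v^T P_i(0) v <> 0 would force
   lam_i to be as small as v^T K v. *)
Lemma large_orth n p (K : R -> 'M[R]_n) (lam : 'I_n -> R -> R) (P : 'I_n -> R -> 'M[R]_n)
    (P0 : 'M[R]_n) (v : 'cV[R]_n) i :
  near0p (fun e => psd (K e)) ->
  near0p (fun e => [/\ forall i, (P i e)^T = P i e,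
    forall i j, P i e *m P j e = (if i == j then P i e else 0) &
    K e = \sum_j lam j e *: P j e]) ->
  mxO 1 (fun e => P i e - P0) -> P0^T = P0 -> P0 *m P0 = P0 ->
  mxO p (fun e => v^T *m K e *m v) ->
  ~ bigO_pow p (lam i) -> P0 *m v = 0.
Proof.
move=> Kpsd hP PO PT PP vKv nlam.
(* For a symmetric idempotent this number is the squared norm of P0 v. *)
suff h0 : (v^T *m P0 *m v) 0 0 = 0.
  apply: trmulT_eq0; rewrite trmx_mul PT mulmxA -(mulmxA v^T P0) PP.
  by rewrite [_ *m v]mx11_scalar h0 raddf0 mxtrace0.
apply/eqP/negPn/negP => c0; apply: nlam.
apply: (bigO_cancel _ _ (fun e => (v^T *m P i e *m v) 0 0) _ c0).
  have h := mxO_mul _ _ _ 1 0 _ _ (mxO_mull _ _ _ v^T _ _ PO) (mxO_const _ _ v).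
  apply: bigO_ext (h 0 0); exists 1 => // e _.
  by rewrite mulmxBr mulmxBl !mxE.
have [C hC] := vKv 0 0; exists C.
apply: (near0p_imp _ (near0p_and _ _ hC (near0p_and _ _ Kpsd hP))) => e e0.
move=> [hle [psdK [eT eP eK]]]; apply: le_trans hle.
have term j : (v^T *m (lam j e *: P j e) *m v) 0 0 = lam j e * (v^T *m P j e *m v) 0 0.
  by rewrite -scalemxAr -scalemxAl mxE.
have KP j : K e *m P j e = lam j e *: P j e.
  rewrite eK mulmx_suml (bigD1 j)//= -scalemxAl eP eqxx big1 ?addr0// => l lj.
  by rewrite -scalemxAl eP (negPf lj) scaler0.
(* Semidefiniteness is tested on the vector P_j v. *)
have pos j : 0 <= lam j e * (v^T *m P j e *m v) 0 0.
  have := psdK (P j e *m v); rewrite trmx_mul eT -!mulmxA (mulmxA (K e)) KP.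
  by rewrite -scalemxAl -!scalemxAr mxE (mulmxA (P j e)) eP eqxx mulmxA.
have -> : (v^T *m K e *m v) 0 0 = \sum_j lam j e * (v^T *m P j e *m v) 0 0.
  rewrite eK mulmx_sumr mulmx_suml summxE.
  by apply: eq_bigr => j _; exact: term.
rewrite ger0_norm ?pos// ger0_norm ?sumr_ge0// (bigD1 i)//= lerDl sumr_ge0//.
Qed.
End LargeEigenvalue.

(** * Separation of the limiting projectors and choice of the eigenvectors *)

Theorem theorem8p1 (R : realType) (d n r : nat) (b eps0 : R) (f : R -> R)
  (x : 'I_n -> 'rV[R]_d)
  (Q : 'M[R]_n) (Rf : 'M[R]_(n, nP d r.-1)) :
  (0 < r)%N -> 0 < b -> Ck_on (2 * r) b f ->
  (forall l : nat, (1 <= l < r)%N -> derive1n (2 * l).-1 f 0 = 0) ->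
  derive1n (2 * r).-1 f 0 != 0 ->
  (nP d r.-1 <= n)%N ->
  0 < eps0 ->
  (forall e, 0 <= e <= eps0 -> psd (Kmx f x e)) ->
  analytic_mx0 (Kmx f x) ->
  (* full QR factorization V_{<= r-1} = Q Rf, Q orthogonal, Rf upper triangular *)
  Q^T *m Q = 1%:M -> upper_trig Rf -> Vmx r.-1 x = Q *m Rf ->
  \det (Wmx d r.-1 f) != 0 ->
  \rank (Vmx r.-1 x) = nP d r.-1 ->
  (Qperp (nP d r.-1) Q)^T *m Dmx (2 * r).-1 x *m Qperp (nP d r.-1) Q \in unitmx ->
  forall (lam : 'I_n -> R -> R) (P : 'I_n -> R -> 'M[R]_n),
    analytic_eigdec (Kmx f x) lam P ->
    exists U : 'M[R]_(n - nP d r.-1),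
    exists sigma : 'I_(n - nP d r.-1) -> 'I_n,
      [/\ injective sigma,
          (forall j, eigvec ((Qperp (nP d r.-1) Q)^T *m Dmx (2 * r).-1 x
                              *m Qperp (nP d r.-1) Q) (col j U)),
          (forall i, bigO_pow (2 * r).-1 (lam i) <-> exists j, sigma j = i) &
          (forall j, P (sigma j) 0 =
             (Qperp (nP d r.-1) Q *m col j U) *m (Qperp (nP d r.-1) Q *m col j U)^T)].
Proof.
case: r Rf => [//|k] Rf _ b0 fC fodd; rewrite [k.+1.-1]/=.
have -> : (2 * k.+1).-1 = (2 * k).+1 by rewrite mulnS.
set N := nP d k => fn0 Nn eps0_gt0 Kpsd _ QQ Ru VQR Wdet Vrank _ lam P.
case=> _ [Pan [delta d0 dec]].
set B := Qperp N Q; set D := Dmx _ x; set V := Vmx k x in VQR Vrank.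
have BB : B^T *m B = 1%:M by exact: Qperp_orth.
have BV : B^T *m V = 0 by rewrite VQR; exact: Qperp_QR.
have VB : V^T *m B = 0 by rewrite -[LHS]trmxK trmx_mul trmxK BV trmx0.
have [E EO KE] := Kmx_expansion _ _ _ f x b b0 fC fodd.
set c := derive1n (2 * k).+1 f 0 / _ in KE.
have c0 : c != 0 by rewrite mulf_neq0// invr_eq0 pnatr_eq0 -lt0n fact_gt0.
have Wu : Wmx d k f \in unitmx by rewrite unitmxE unitfE.
have Vfull : row_full V by rewrite /row_full Vrank.
have [PT PP Prank _] := dec 0 ltac:(by rewrite normr0).
have PPi i : P i 0 *m P i 0 = P i 0 by rewrite PP eqxx.
have PO i : mxO 1 (fun e => P i e - P i 0) := analytic_mx0_mxO _ _ (Pan i).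
have nearP : near0p (fun e => [/\ forall i, (P i e)^T = P i e,
    forall i j, P i e *m P j e = (if i == j then P i e else 0) &
    Kmx f x e = \sum_j lam j e *: P j e]).
  by exists delta => // e /andP[e0 ed]; have [] := dec e; rewrite ?gtr0_norm.
have nearpsd : near0p (fun e => psd (Kmx f x e)).
  by exists eps0 => // e /andP[e0 ee]; apply: Kpsd; rewrite !ltW.
have KP i : near0p (fun e => Kmx f x e *m P i e = lam i e *: P i e).
  apply: near0p_imp nearP _ => e _ [_ eP ->].
  rewrite mulmx_suml (bigD1 i)//= -scalemxAl eP eqxx big1 ?addr0// => l lj.
  by rewrite -scalemxAl eP (negPf lj) scaler0.
pose S := [set i | `[< bigO_pow (2 * k).+1 (lam i) >]]%SET.
have small i : i \in S -> B *m B^T *m P i 0 = P i 0.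
  rewrite inE => /asboolP lamO; apply: (orth_complement _ _ _ V) => //.
  exact: (small_orth _ _ _ f x c E EO KE (lam i) (P i)).
have large i : i \notin S -> B^T *m P i 0 = 0.
  rewrite inE => /asboolP nlam.
  (* By symmetry it is enough that the limiting projector kills every column of B; [large_orth]
     handles the columns one by one. *)
  suff PB : P i 0 *m B = 0 by rewrite -(PT i) -trmx_mul PB trmx0.
  apply/matrixP => a j; rewrite [RHS]mxE.
  have : P i 0 *m col j B = 0.
    apply: (large_orth _ (2 * k).+1 (Kmx f x) lam P _ _ i) => //.
    have Vj : V^T *m col j B = 0 by rewrite colE mulmxA VB mul0mx.
    have jV : (col j B)^T *m V = 0 by rewrite -[LHS]trmxK trmx_mul trmxK Vj trmx0.
    set v := col j B.
    (* As v is orthogonal to V, only the D term and the remainder survive in v^T K v. *)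
    apply: (mxO_ext _ _ _ _ (fun e => (c * e ^+ (2 * k).+1) *: (v^T *m D *m v) + v^T *m E e *m v)).
      exists 1 => // e _; rewrite KE !mulmxDr !mulmxDl -!mulmxA.
      by rewrite !(mulmxA v^T V) jV Vj !(mul0mx, mulmx0) !add0r -scalemxAl -scalemxAr !mulmxA.
    apply: mxO_add.
      apply: (mxO_weaken _ _ _ ((2 * k).+1 + 0)); first by lia.
      apply: mxO_scale; last exact: mxO_const.
      exact: bigO_mul 0 _ _ _ (bigO_const c) (bigO_exp _).
    apply: (mxO_weaken _ _ _ (2 * k.+1 + 0)); first by lia.
    by apply: mxO_mul; [exact: mxO_mull|exact: mxO_const].
  by rewrite colE mulmxA -colE => /matrixP/(_ a 0); rewrite !mxE.
(* The projectors sum to 1; B B^T fixes those indexed by [S] and annihilates the others. *)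
have BBsum : B *m B^T = \sum_(i in S) P i 0.
  rewrite -[LHS]mulmx1 -(projectors_sum1 _ (fun i => P i 0))// mulmx_sumr.
  rewrite [RHS]big_mkcond/=; apply: eq_bigr => i _.
  by case: ifPn => iS; [exact: small|rewrite -mulmxA large// mulmx0].
(* Both sides of [BBsum] are traced: each projector has trace 1, and B^T B = 1 has size n - N. *)
have Scard : #|S| = (n - N)%N.
  apply/eqP; rewrite -(eqr_nat R); apply/eqP.
  transitivity (\tr (B *m B^T)); last by rewrite mxtrace_mulC BB mxtrace1.
  rewrite BBsum raddf_sum (eq_bigr (fun=> 1)) ?sumr_const// => i _.
  exact: rank1_projector_trace.
have /choice[p hp] : forall i, exists v : 'cV[R]_n,
    [/\ P i 0 = v *m v^T, v^T *m v = 1%:M & P i 0 *m v = v].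
  by move=> i; exact: rank1_projector.
pose sigma (j : 'I_(n - N)) : 'I_n := enum_val (cast_ord (esym Scard) j).
pose U : 'M[R]_(n - N) := \matrix_(a, j) (B^T *m p (sigma j)) a 0.
have colU j : col j U = B^T *m p (sigma j).
  by apply/matrixP => a z; rewrite ord1 !mxE.
have sigmaS j : sigma j \in S by exact: enum_valP.
(* p lies in the range of its projector, which B B^T fixes. *)
have BU j : B *m col j U = p (sigma j).
  have [_ _ Pp] := hp (sigma j).
  by rewrite colU mulmxA -Pp mulmxA small.
exists U, sigma; split.
- by move=> j1 j2 /enum_val_inj/cast_ord_inj.
- move=> j; have [Pv v1 Pp] := hp (sigma j).
  have pn0 : p (sigma j) != 0.
    apply/eqP => p0; move: (Prank (sigma j)).
    by rewrite Pv p0 mul0mx mxrank0.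
  split; first by apply: contraNneq pn0 => U0; rewrite -BU U0 mulmx0.
  (* Otherwise p = B B^T P p would vanish. *)
  have BP0 : B^T *m P (sigma j) 0 != 0.
    apply: contraNneq pn0 => BP0.
    by rewrite -Pp -small// -(mulmxA B) BP0 mulmx0 mul0mx.
  have /asboolP lamO : `[< bigO_pow (2 * k).+1 (lam (sigma j)) >].
    by have := sigmaS j; rewrite inE.
  have [mu hmu] := small_eigen _ _ _ f x c E EO KE _ _ _ lamO (PO _) (KP _) Wu Vfull _ B BV c0 BP0.
  exists mu; rewrite -mulmxA BU colU -Pp !mulmxA hmu.
  by rewrite -scalemxAl.
- move=> i; split=> [lamO|[j <-]]; last by have := sigmaS j; rewrite inE => /asboolP.
  have iS : i \in S by rewrite inE; exact/asboolP.
  exists (cast_ord Scard (enum_rank_in iS i)).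
  by rewrite /sigma cast_ordK enum_rankK_in.
- by move=> j; rewrite BU; have [] := hp (sigma j).
Qed.
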